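(* There is an absolute constant $c>0$ such that for every $n$ and every nontrivial arrangement $\mathcal{L}$ of $n$ pseudolines, there is a pseudoline in $\mathcal{L}$ that is incident to at least $cn$ crossing points of $\mathcal{L}$. In particular, one may take $c=1/845$ for large $n$; that is, there is an $n_0$ such that for every $n\ge n_0$, every nontrivial arrangement of $n$ pseudolines contains a pseudoline incident to at least $n/845$ crossing points.
   Context: An (Euclidean) arrangement of $n$ pseudolines is a family of $n$ two-way infinite $x$-monotone curves in the plane $\mathbb{R}^2$ such that any two of the curves have precisely one point in common, at which they properly cross. Three or more pseudolines may pass through a common point. A crossing point (vertex) of the arrangement is a point lying on at least two of the pseudolines; a pseudoline is incident to a crossing point if it passes through it, and crossing points are counted as distinct points (without multiplicity). The arrangement is nontrivial if not all pseudolines cross at a single point; equivalently, the sequence of permutations of $1,\dots,n$ obtained by sweeping the arrangement by a vertical line from left to right has more than two permutations (in particular $n\ge 3$). *)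

(* Defs.v *)
From HB Require Import structures.
From mathcomp Require Import all_boot all_order all_algebra.
From mathcomp Require Import finmap.
From mathcomp Require Import all_classical all_reals all_analysis.
Set Implicit Arguments.
Unset Strict Implicit.
Unset Printing Implicit Defensive.
Import Order.TTheory GRing.Theory Num.Theory.
Import numFieldNormedType.Exports.
Local Open Scope classical_set_scope.
Local Open Scope ring_scope.

(* A two-way infinite x-monotone curve meets every vertical line exactly once:
   it is the graph of a continuous function defined on the whole of R, and is
   represented by that function. *)
Definition curve (R : realType) (f : R -> R) : set (R * R) :=
  [set p | p.2 = f p.1].

(* The curves of f and g exchange sides at abscissa x: a local condition, so
   tangential contacts are excluded. *)
Definition properly_cross_at (R : realType) (f g : R -> R) (x : R) : Prop :=
  ((\forall y \near x^'-, f y < g y) /\ (\forall y \near x^'+, g y < f y)) \/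
  ((\forall y \near x^'-, g y < f y) /\ (\forall y \near x^'+, f y < g y)).

Definition pseudoline_arrangement (R : realType) (n : nat)
    (L : 'I_n -> R -> R) : Prop :=
  (forall i, continuous (L i)) /\
  (forall i j, i != j -> exists p : R * R,
     curve (L i) `&` curve (L j) = [set p] /\
     properly_cross_at (L i) (L j) p.1).

Definition nontrivial (R : realType) (n : nat) (L : 'I_n -> R -> R) : Prop :=
  ~ exists p : R * R, forall i, curve (L i) p.

Definition crossing_point (R : realType) (n : nat) (L : 'I_n -> R -> R) :
    set (R * R) :=
  [set p | exists i j, i != j /\ curve (L i) p /\ curve (L j) p].

Definition incident_crossing_points (R : realType) (n : nat)
    (L : 'I_n -> R -> R) (i : 'I_n) : set (R * R) :=
  crossing_point L `&` curve (L i).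

(* [fset_set] returns the empty set on infinite sets; in an arrangement this
   never happens, by [finite_incident_crossing_points]. *)
Definition num_incident_crossing_points (R : realType) (n : nat)
    (L : 'I_n -> R -> R) (i : 'I_n) : nat :=
  #|` fset_set (incident_crossing_points L i) |.

Lemma finite_incident_crossing_points (R : realType) (n : nat)
    (L : 'I_n -> R -> R) (i : 'I_n) :
  pseudoline_arrangement L -> finite_set (incident_crossing_points L i).
Proof.
move=> [_ HL].
apply: (@sub_finite_set _ _
  (\bigcup_(j in [set j | j != i]) (curve (L i) `&` curve (L j)))).
  move=> p [[j [k [jk [pj pk]]]] pi].
  have [jE|ji] := eqVneq j i; last by exists j.
  by exists k => //=; rewrite -jE eq_sym.
apply: bigcup_finite; first exact: finite_finset.
move=> j /= ji; have [|p [-> _]] := HL i j; first by rewrite eq_sym.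
exact: finite_set1.
Qed.

(* Main.v *)
Require Import Defs.
From mathcomp Require Import all_boot all_order all_algebra.
From mathcomp Require Import finmap.
From mathcomp Require Import all_classical all_reals all_analysis.
From mathcomp Require Import zify ring lra.
Set Implicit Arguments.
Unset Strict Implicit.
Unset Printing Implicit Defensive.
Import Order.TTheory GRing.Theory Num.Theory.
Import numFieldNormedType.Exports.
Local Open Scope ring_scope.

(** The theorem is the dual form, for pseudolines, of the weak Dirac conjecture
    proved by Beck and by Szemeredi and Trotter.  The proof is a crossing-number
    argument in the style of Szekely, carried out directly on the curves.

    Take the crossing points as vertices, and let mult v be the number of
    pseudolines through v.  For a set P of vertices, cut each pseudoline at its
    points of P; the arcs between consecutive points are the edges of a graph
    drawn with x-monotone edges.  It has at least (sum over P of mult) - n edges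
    [incidences_le], and at most n ^ 2 ordered pairs of edges cross, because two
    pseudolines meet once [card_crossings].  If no two edges cross, there are at
    most 4 |P| edges [card_noncrossing].  Deleting every edge involved in a
    crossing, and applying this to a random subset of P in which each vertex is
    kept with probability 1 / q, gives the crossing inequality
      q ^ 2 |edges| <= 4 q ^ 3 |P| + n ^ 2          [edge_bound].
    Taking for P the vertices with mult v > 4 q, one gets a bound on the
    incidence excess
      D q := sum over v of (mult v - 4 q)^+ <= n + n ^ 2 / q ^ 2   [rich_excess].

    Suppose now that each pseudoline carries at most s vertices.  All pairs of
    pseudolines meet, so n ^ 2 <= sum of mult v ^ 2, and m ^ 2 is at most
    8 times the sum over q of (m - 4 q)^+, hence n ^ 2 <= 8 * (sum over q of D q).
    Nontriviality gives mult v <= s: some pseudoline misses v, and it meets those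
    through v in distinct points.  So only q <= s occur.  For small q,
    D q <= sum of mult <= n s; for large q, the excess bound is summable.  Cutting
    at q = 30 yields n ^ 2 <= 8 (31 n s + n ^ 2 / 29), so n <= 343 s, for
    every n [counting_bound].

    The bound 4 |P| for non-crossing x-monotone graphs takes the place of Euler's
    formula and uses only the order of the curves on vertical lines.  Each edge
    that is not the lowest one arriving from the left at its right endpoint
    bounds, with the next lower one, a wedge; sweep the wedge from its apex to
    the left until a vertex is met.  That vertex is the left end of the upper
    edge, the left end of the lower edge, or interior to the wedge, and in each
    of the three cases it determines the edge, because no other edge can have
    entered the wedge [wedge_trap]. *)

(** * Summing the excess bounds *)

(** The terms of the sum decrease in steps of 4, so it is at least the area
    m ^ 2 / 8 of a triangle of height m and slope 4. *)
Lemma square_le_excess m N :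
  (m <= 4 * N.+1)%N -> (m ^ 2 <= 8 * \sum_(q < N.+1) (m - 4 * q))%N.
Proof.
elim: N m => [|N IH] m mN; first by rewrite big_ord1 muln0 subn0; nia.
rewrite big_ord_recl /= muln0 subn0.
have [m4|m4] := leqP m 4; first by nia.
rewrite (eq_bigr (fun q : 'I_N.+1 => m - 4 - 4 * q)%N); last first.
  by move=> q _; rewrite /bump leq0n add1n mulnS subnDA.
have := IH (m - 4)%N.
move=> /(_ ltac:(lia)); move: (\sum_(q < N.+1) _)%N => T.
have [k ->] : exists k, m = (k + 4)%N by exists (m - 4)%N; lia.
rewrite addnK -!mulnn; nia.
Qed.

(** The bound on [D q] is n + n ^ 2 / q ^ 2, and 1 / q ^ 2 is at most
    1 / (q - 1) - 1 / q, which telescopes. *)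
Lemma sum_inverse_square_le (D : nat -> nat) n a M : (1 < a)%N ->
  (forall q, (a <= q)%N -> (q ^ 2 * D q <= q ^ 2 * n + n ^ 2)%N) ->
  (\sum_(k < M) D (a + k)%N)%:R <=
    M%:R * n%:R + n%:R ^+ 2 * ((a.-1)%:R^-1 - (a.-1 + M)%:R^-1) :> rat.
Proof.
move=> a1 H; elim: M => [|M IH]; first by rewrite big_ord0 addn0 subrr; lra.
rewrite big_ord_recr /= natrD.
have := H (a + M)%N (leq_addr _ _).
have -> : (a + M = (a.-1 + M).+1)%N by lia.
rewrite addnS; set b := (a.-1 + M)%N in IH *.
have b0 : 0 < b%:R :> rat by rewrite ltr0n /b; lia.
set d := D _; rewrite -(ler_nat rat) natrD !natrM -natr1 => Hd.
have Hd2 : d%:R <= n%:R + n%:R ^+ 2 * (b%:R^-1 - (b%:R + 1)^-1) :> rat.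
  have b1 : 0 < b%:R + 1 :> rat by lra.
  have -> : b%:R^-1 - (b%:R + 1)^-1 = (b%:R * (b%:R + 1))^-1 :> rat.
    by field; apply/andP; split; rewrite gt_eqF.
  rewrite -lerBlDl ler_pdivlMr ?mulr_gt0//.
  nra.
rewrite -[M.+1]addn1 natrD -natr1; nra.
Qed.

(** Here [mu] stands for the multiplicities of the vertices and [s] for the
    largest number of vertices on a pseudoline.  The excess bound is useless for
    small [q], where [Hsum] is used instead. *)
Lemma counting_bound (V : finType) (mu : V -> nat) n s :
  (n ^ 2 <= \sum_v mu v ^ 2)%N -> (\sum_v mu v <= n * s)%N -> (forall v, mu v <= s)%N ->
  (forall q, (0 < q)%N -> (q ^ 2 * (\sum_v (mu v - 4 * q)) <= q ^ 2 * n + n ^ 2)%N) ->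
  (n <= 845 * s)%N.
Proof.
move=> Hsq Hsum Hmax Hrich; pose D q := (\sum_v (mu v - 4 * q))%N.
have DE : (n ^ 2 <= 8 * \sum_(q < s.+1) D q)%N.
  apply: leq_trans Hsq _; rewrite /D exchange_big big_distrr /=.
  by apply: leq_sum => v _; apply: square_le_excess; have := Hmax v; lia.
have Dns q : (D q <= n * s)%N.
  by apply: leq_trans Hsum; apply: leq_sum => v _; exact: leq_subr.
have Dsmall N : (\sum_(q < N) D q <= N * (n * s))%N.
  by rewrite -[N in (_ <= N * _)%N]card_ord -sum_nat_const; apply: leq_sum => q _.
(* The threshold 30 makes both 8 * 31 / 845 and 8 / 29 small enough for their sum
   to be less than 1; the linear terms n of the excess bound account for one
   extra n * s. *)
have Dall : (\sum_(q < s.+1) D q)%:R <= 31 * (n * s)%:R + n%:R ^+ 2 / 29 :> rat.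
  have nn : 0 <= n%:R ^+ 2 :> rat by rewrite sqr_ge0.
  have ns : 0 <= (n * s)%:R :> rat by [].
  have [s30|s30] := leqP s.+1 30.
    have : (\sum_(q < s.+1) D q)%:R <= (30 * (n * s))%:R :> rat.
      by rewrite ler_nat; apply: leq_trans (Dsmall _) _; rewrite leq_mul2r s30 orbT.
    rewrite natrM; lra.
  have -> : (s.+1 = 30 + (s.+1 - 30))%N by lia.
  set M := (s.+1 - 30)%N; rewrite big_split_ord /= natrD.
  have A : (\sum_(q < 30) D q)%:R <= 30%:R * (n * s)%:R :> rat.
    by rewrite -natrM ler_nat.
  have B := @sum_inverse_square_le D n 30 M isT _.
  have {}B := B (fun q h => Hrich q (leq_ltn_trans (leq0n 29) h)).
  have C : M%:R * n%:R <= (n * s)%:R :> rat by rewrite -natrM ler_nat /M; nia.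
  have E : 0 <= n%:R ^+ 2 * (29 + M)%:R^-1 :> rat by rewrite mulr_ge0.
  move: B; rewrite /= mulrBr; lra.
have : (n ^ 2)%:R <= (8 * \sum_(q < s.+1) D q)%:R :> rat by rewrite ler_nat.
rewrite natrX natrM => F.
have G : (n ^ 2 * 21 <= 29 * 8 * 31 * (n * s))%N.
  rewrite -(ler_nat rat) [X in X <= _]natrM natrX !natrM; rewrite natrM in Dall; lra.
have [->//|n0] := posnP n.
have : (n * 21 <= 29 * 8 * 31 * s)%N by rewrite -(leq_pmul2l n0); nia.
lia.
Qed.

(** * Finite sets and continuous functions *)

(** The relational form of an injection: a charging scheme need not choose its
    charges. *)
Lemma card_le_rel (T U : finType) (A : {set T}) (B : {set U})
    (r : T -> U -> Prop) :
  (forall e, e \in A -> exists2 u, u \in B & r e u) ->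
  (forall e f u, e \in A -> f \in A -> r e u -> r f u -> e = f) ->
  (#|A| <= #|B|)%N.
Proof.
move=> rex rinj.
have [->|[e0 e0A]] := set_0Vmem A; first by rewrite cards0.
have [u0 _ _] := rex e0 e0A.
pose c e := odflt u0 [pick u in B | `[< r e u >]].
have cP e : e \in A -> c e \in B /\ r e (c e).
  move=> eA; rewrite /c; case: pickP => [u /andP[uB /asboolP]//|no].
  by have [u uB reu] := rex e eA; have := no u; rewrite uB /=; case: asboolP.
rewrite -(@card_in_imset _ _ c).
  by apply/subset_leq_card/fintype.subsetP => u /imsetP[e /cP[? _] ->].
move=> e f eA fA cef; apply: (rinj e f (c e)) => //.
  by have [] := cP e eA.
by rewrite cef; have [] := cP f fA.
Qed.

Lemma finset_max_witness (R : realType) (T : finType) (A : {set T}) (k : T -> R) t0 :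
  t0 \in A -> exists2 t, t \in A & forall s, s \in A -> k s <= k t.
Proof.
move=> t0A; case: (@arg_maxP _ _ _ t0 (mem A) k t0A) => t tA tmax.
by exists t => // s sA; exact: tmax.
Qed.

Lemma crossing_between (R : realType) (f g : R -> R) (a b : R) :
  continuous f -> continuous g -> a < b -> f a < g a -> g b < f b ->
  exists2 c, a < c < b & f c = g c.
Proof.
move=> cf cg ab fga gfb.
have [||c] := @IVT R (f \- g) a b 0 (ltW ab).
- by apply: continuous_subspaceT => x; apply: cvgB; [exact: cf|exact: cg].
- rewrite /=; apply/andP; split.
    by rewrite ge_min subr_le0 (ltW fga).
  by rewrite le_max orbC subr_ge0 (ltW gfb).
rewrite in_itv /= => /andP[ac cb] /eqP; rewrite subr_eq0 => /eqP fgc.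
exists c => //; rewrite !lt_neqAle ac cb !andbT.
apply/andP; split; apply/eqP => E.
  by move: fga; rewrite E fgc ltxx.
by move: gfb; rewrite -E fgc ltxx.
Qed.

(** * Graphs drawn along the curves *)

(** Of a pseudoline arrangement, only continuity and the fact that two curves
    meet at most once are kept; the vertices may be any finite set of points. *)
Section PlaneGraph.
Context (R : realType) (n : nat) (L : 'I_n -> R -> R).
Context (V : finType) (pt : V -> R * R).
Hypothesis L_cont : forall i, continuous (L i).
Hypothesis L_once : forall i j x y, i != j -> L i x = L j x -> L i y = L j y -> x = y.
Hypothesis pt_inj : injective pt.

Notation px v := (pt v).1.
Notation py v := (pt v).2.

Lemma vertex_eq u v : px u = px v -> py u = py v -> u = v.
Proof.
move=> xE yE; apply: pt_inj.
by rewrite (surjective_pairing (pt u)) (surjective_pairing (pt v)) xE yE.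
Qed.

Definition on (i : 'I_n) (v : V) : bool := py v == L i (px v).

(** The triple (i, u, v) stands for the arc of curve i from u to v. *)
Definition edge : finType := ('I_n * V * V)%type.
Implicit Types (e f g h : edge) (u v w : V) (S P : {set V}) (G : {set edge}).

Definition line e : 'I_n := e.1.1.
Definition lft e : V := e.1.2.
Definition rgt e : V := e.2.
Notation lx e := (px (lft e)).
Notation rx e := (px (rgt e)).
Notation "e @@ x" := (L (line e) x) (at level 20).

Definition edges S : {set edge} :=
  [set e | [&& lft e \in S, rgt e \in S, on (line e) (lft e),
    on (line e) (rgt e), lx e < rx e &
    [forall w in S, on (line e) w ==> ~~ (lx e < px w < rx e)]]].

Lemma edgesP S e :
  reflect [/\ (lft e \in S) /\ rgt e \in S, py (lft e) = e @@ lx e,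
    py (rgt e) = e @@ rx e, lx e < rx e &
    forall w, w \in S -> py w = e @@ px w -> lx e < px w -> px w < rx e -> False]
    (e \in edges S).
Proof.
rewrite inE; apply: (iffP and5P).
  case=> lS rS /eqP ol /eqP or_ /andP[lr /forall_inP H]; split=> // w wS ow lw wr.
  by move: (H w wS); rewrite /on ow eqxx lw wr.
case=> [[lS rS] ol or_ lr H]; split=> //; [exact/eqP|exact/eqP|].
rewrite lr /=; apply/forall_inP => w wS; apply/implyP => /eqP ow.
by apply/negP => /andP[lw wr]; apply: H wS ow lw wr.
Qed.

Definition noncrossing G : Prop := forall e f x, e \in G -> f \in G ->
  lx e < x < rx e -> lx f < x < rx f -> e @@ x = f @@ x -> e = f.

(** To the left of a common point, two curves keep their vertical order. *)
Lemma same_side_left i j v x y : on i v -> on j v -> x < px v -> y < px v ->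
  L i x < L j x -> L i y < L j y.
Proof.
move=> /eqP iv /eqP jv xv yv ijx.
have ij : i != j by apply: contraTneq ijx => ->; rewrite ltxx.
have no c : c < px v -> L i c = L j c -> False.
  move=> cv ijc; move: cv; rewrite (L_once ij ijc (etrans (esym iv) jv)).
  by rewrite ltxx.
have [//|jiy|ijy] := ltgtP (L i y) (L j y); last by case: (no y yv ijy).
have [xy|yx|xy] := ltgtP x y.
- have [c /andP[_ cy] ijc] := crossing_between (@L_cont i) (@L_cont j) xy ijx jiy.
  by case: (no c (lt_trans cy yv) ijc).
- have [c /andP[_ cy] jic] := crossing_between (@L_cont j) (@L_cont i) yx jiy ijx.
  by case: (no c (lt_trans cy xv) (esym jic)).
- by move: jiy; rewrite -xy ltNge (ltW ijx).
Qed.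

(** * Non-crossing graphs have few edges *)

Section Charging.
Context (S : {set V}) (G : {set edge}).
Hypothesis GS : G \subset edges S.
Hypothesis G_nc : noncrossing G.

Let G_edgeP e (eG : e \in G) := edgesP S e (fintype.subsetP GS e eG).

Lemma stays_below e f a b : e \in G -> f \in G -> a < b -> lx e <= a -> lx f <= a ->
  b <= rx e -> b <= rx f -> e @@ a < f @@ a -> e @@ b <= f @@ b.
Proof.
move=> eG fG ab le lf re rf efa; rewrite leNgt; apply/negP => feb.
have [c /andP[ac cb] efc] :=
  crossing_between (@L_cont (line e)) (@L_cont (line f)) ab efa feb.
move: efa; rewrite (G_nc eG fG _ _ efc) ?ltxx//; apply/andP; split.
- exact: le_lt_trans ac.
- exact: lt_le_trans re.
- exact: le_lt_trans ac.
- exact: lt_le_trans rf.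
Qed.

Lemma stays_below_strict e f a b : e \in G -> f \in G -> a < b ->
  lx e <= a -> lx f <= a -> b < rx e -> b < rx f -> e @@ a < f @@ a -> e @@ b < f @@ b.
Proof.
move=> eG fG ab le lf re rf efa.
rewrite lt_neqAle (stays_below eG fG ab le lf (ltW re) (ltW rf) efa) andbT.
apply: contraTneq efa => efb; rewrite (G_nc eG fG _ _ efb) ?ltxx//.
  by apply/andP; split=> //; exact: le_lt_trans ab.
by apply/andP; split=> //; exact: le_lt_trans ab.
Qed.

(** Edges arriving from the left at a common right endpoint v are ordered by the
    heights of their curves at distance 1 to the left of v.  An edge may
    be shorter than that, but its curve goes on, and by [same_side_left] any
    abscissa left of v would give the same order. *)
Definition key e : R := e @@ (rx e - 1).

Lemma key_lt e f x : e \in G -> f \in G -> rgt e = rgt f -> x < rx f ->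
  (key e < key f) = (e @@ x < f @@ x).
Proof.
move=> eG fG ef xf; rewrite /key ef.
have [_ _ /eqP oe _ _] := G_edgeP eG; have [_ _ /eqP of_ _ _] := G_edgeP fG.
have v1 : px (rgt f) - 1 < px (rgt f) by rewrite ltrBlDr ltrDl.
rewrite ef in oe; apply/idP/idP; exact: (same_side_left (v := rgt f)).
Qed.

(** Equal keys force equal curves, which would otherwise meet twice; then
    the edges overlap near their common right end. *)
Lemma key_inj e f : e \in G -> f \in G -> rgt e = rgt f -> key e = key f -> e = f.
Proof.
move=> eG fG ef kef.
have [_ _ oe lre _] := G_edgeP eG; have [_ _ of_ lrf _] := G_edgeP fG.
have lef : line e = line f.
  apply/eqP; apply: contraT => nef.
  have : rx f - 1 = rx f.
    apply: L_once nef _ _; first by move: kef; rewrite /key ef.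
    by rewrite -of_ -ef oe.
  by move=> /eqP; rewrite lt_eqF// ltrBlDr ltrDl.
have m : Num.max (lx e) (lx f) < rx f by rewrite gt_max lrf -ef lre.
have [] := midf_lt m; set x := (X in _ < X); rewrite gt_max => /andP[a b] c.
by apply: (G_nc (x := x) eG fG); rewrite ?ef ?a ?b ?c ?lef.
Qed.

(** [g] and [f] are consecutive, [g] below [f], among the edges arriving at a
    common right endpoint, the apex of the wedge. *)
Definition wedge g f : Prop := [/\ g \in G, f \in G, rgt g = rgt f, key g < key f &
  forall h, h \in G -> rgt h = rgt f -> key g < key h -> key h < key f -> False].

Definition empty_beyond g f x0 : Prop := forall w, w \in S -> x0 < px w -> px w < rx f ->
  g @@ px w < py w -> py w < f @@ px w -> False.

(** An edge inside an empty part of a wedge has no way out: it cannot cross the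
    sides, it cannot end before the apex since there is no vertex there, and it
    cannot end at the apex because the sides are consecutive. *)
Lemma wedge_trap g f e x0 : wedge g f -> empty_beyond g f x0 -> e \in G ->
  lx g <= x0 -> lx f <= x0 -> x0 < rx f -> lx e <= x0 -> x0 < rx e ->
  g @@ x0 < e @@ x0 -> e @@ x0 < f @@ x0 -> False.
Proof.
move=> [gG fG gf kgf cons] emp eG lg lf xf le xe gex efx.
have [[_ rgS] _ ogr _ ing] := G_edgeP gG; have [[_ rfS] _ ofr _ inf] := G_edgeP fG.
have [[_ reS] _ oer _ ine] := G_edgeP eG.
have pvg : py (rgt f) = g @@ rx f by rewrite -gf.
(* [e] may end before the apex, pass its abscissa, or end exactly there.
   Touching a side or the apex is excluded too: edges have no vertices in their
   interiors. *)
have [ef|fe|ef] := ltgtP (rx e) (rx f).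
- have := stays_below eG fG xe le lf (lexx _) (ltW ef) efx.
  rewrite le_eqVlt => /orP[/eqP E|eltf].
    by apply: (inf _ reS _ _ ef); [rewrite oer|exact: le_lt_trans xe].
  have rge : rx e <= rx g by rewrite gf ltW.
  have := stays_below gG eG xe lg le rge (lexx _) gex.
  rewrite le_eqVlt => /orP[/eqP E|glte].
    apply: (ing _ reS); [by rewrite oer|exact: le_lt_trans xe|].
    by rewrite gf.
  by apply: (emp _ reS) => //; rewrite oer.
- have A := stays_below eG fG xf le lf (ltW fe) (lexx _) efx.
  have B := stays_below gG eG xf lg le _ (ltW fe) gex.
  apply: (ine _ rfS) => //; last exact: le_lt_trans xf.
  by apply: le_anti; apply/andP; split; [rewrite pvg B ?gf|rewrite ofr A].
- have A := stays_below eG fG xf le lf _ (lexx _) efx.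
  have B := stays_below gG eG xf lg le _ _ gex.
  have E : rgt e = rgt f.
    apply: vertex_eq => //; apply: le_anti; rewrite oer ef.
    by apply/andP; split; [rewrite ofr A ?ef|rewrite pvg B ?gf ?ef].
  apply: (cons _ eG E).
    by rewrite (key_lt (x := x0)) ?gf ?E.
  by rewrite (key_lt (x := x0)) ?E.
Qed.

(** The four kinds of charges of an edge.  The last three correspond to what a
    leftward sweep of the wedge below [e] meets first.  Treating the left ends
    of the two sides separately from the vertices strictly inside keeps ties of
    abscissae harmless: the latter lie strictly to the right of both left ends. *)
Definition lowest e u : Prop :=
  rgt e = u /\ forall g, g \in G -> rgt g = rgt e -> key g < key e -> False.

Definition starts_last e u : Prop :=
  exists g, [/\ wedge g e, lft e = u, lx g <= px u & empty_beyond g e (px u)].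

Definition lower_starts_last e u : Prop :=
  exists g, [/\ wedge g e, lft g = u, lx e <= px u & empty_beyond g e (px u)].

Definition last_inside e u : Prop :=
  exists g, [/\ wedge g e, [/\ lx g < px u, lx e < px u & px u < rx e],
    g @@ px u < py u, py u < e @@ px u & empty_beyond g e (px u)].

Lemma lowest_inj e f u : e \in G -> f \in G -> lowest e u -> lowest f u -> e = f.
Proof.
move=> eG fG [eu lowe] [fu lowf].
have ef : rgt e = rgt f by rewrite eu.
have [kef|kfe|] := ltgtP (key e) (key f); last exact: key_inj.
  by case: (lowf e).
by case: (lowe f).
Qed.

Lemma wedge_lt g f x : wedge g f -> x < rx f -> g @@ x < f @@ x.
Proof. by move=> [gG fG gf kgf _] xf; rewrite -(key_lt gG fG gf xf). Qed.

(** Two edges leaving the same vertex are compared slightly to the right of it,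
    at an abscissa where both are still present. *)
Lemma same_start_separates e f : e \in G -> f \in G -> lft e = lft f -> e <> f ->
  exists x0, [/\ lx e < x0, x0 < rx e, x0 < rx f & e @@ x0 <> f @@ x0].
Proof.
move=> eG fG ef nef.
have [_ _ _ lre _] := G_edgeP eG; have [_ _ _ lrf _] := G_edgeP fG.
have m : lx e < Num.min (rx e) (rx f) by rewrite lt_min lre ef lrf.
have [] := midf_lt m; set x := (X in _ < X) => b; rewrite lt_min => /andP[c d].
exists x; split=> // E; apply: nef; apply: (G_nc (x := x) eG fG) => //.
  by rewrite b.
by rewrite -ef b.
Qed.

(** The lower of two edges leaving [u] would run inside the wedge below the
    upper one, from [u] onwards. *)
Lemma starts_last_not_above e f x0 u : starts_last e u -> starts_last f u ->
  px u < x0 -> x0 < rx e -> x0 < rx f -> e @@ x0 < f @@ x0 -> False.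
Proof.
move=> [g [[_ eG _ _ _] eu _ _]] [h [hf fu lhu emp]] ux xe xf ef.
have [hG fG rhf khf _] := hf.
have [_ oe _ _ _] := G_edgeP eG; have [_ of_ _ _ _] := G_edgeP fG.
have uf := lt_trans ux xf.
apply: (wedge_trap hf (x0 := x0) _ eG) => //.
- by move=> w wS xw; apply: emp => //; exact: lt_trans xw.
- exact: le_trans (ltW ux).
- by rewrite fu ltW.
- by rewrite eu ltW.
- apply: (stays_below_strict hG eG ux) => //; rewrite ?eu ?rhf//.
  by rewrite -{2}eu -oe eu -fu of_ wedge_lt ?fu.
Qed.

Lemma starts_last_inj e f u : e \in G -> f \in G ->
  starts_last e u -> starts_last f u -> e = f.
Proof.
move=> eG fG eu fu; apply: contrapT => nef.
have leu : lft e = u by case: eu => g [].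
have lfu : lft f = u by case: fu => g [].
have [|x0 []] := same_start_separates eG fG _ nef; first by rewrite leu.
rewrite leu => ux xe xf /eqP; rewrite neq_lt => /orP[].
  exact: (starts_last_not_above eu fu ux).
exact: (starts_last_not_above fu eu ux).
Qed.

(** Here the upper of two edges leaving [u] is the one that runs inside the
    wedge above the other. *)
Lemma lower_not_above g h e f x0 u :
  wedge g e -> wedge h f -> lft g = u -> lft h = u -> lx e <= px u ->
  empty_beyond g e (px u) ->
  px u < x0 -> x0 < rx g -> x0 < rx h -> g @@ x0 < h @@ x0 -> False.
Proof.
move=> ge hf gu hu leu emp ux xg xh gh.
have [gG eG rge kge _] := ge; have [hG _ _ _ _] := hf.
have [_ og _ _ _] := G_edgeP gG; have [_ oh _ _ _] := G_edgeP hG.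
have xe : x0 < rx e by rewrite -rge.
apply: (wedge_trap ge (x0 := x0) _ hG) => //.
- by move=> w wS xw; apply: emp => //; exact: lt_trans xw.
- by rewrite gu ltW.
- exact: le_trans (ltW ux).
- by rewrite hu ltW.
- apply: (stays_below_strict hG eG ux) => //; rewrite ?hu//.
  by rewrite -{1}hu -oh hu -gu og wedge_lt ?gu ?(lt_trans ux).
Qed.

Lemma lower_starts_last_inj e f u : e \in G -> f \in G ->
  lower_starts_last e u -> lower_starts_last f u -> e = f.
Proof.
move=> eG fG [g [ge gu leu empe]] [h [hf hu lfu empf]].
have [gG _ rge kge conse] := ge; have [hG _ rhf khf consf] := hf.
have [gh|/eqP ngh] := eqVneq g h; last first.
  have [|x0 []] := same_start_separates gG hG _ ngh; first by rewrite gu.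
  rewrite gu => ux xe xf /eqP; rewrite neq_lt => /orP[].
    by case/(lower_not_above ge hf gu hu leu empe ux xe xf).
  by case/(lower_not_above hf ge hu gu lfu empf ux xf xe).
have ef : rgt e = rgt f by rewrite -rge gh.
have [kef|kfe|] := ltgtP (key e) (key f); last exact: key_inj.
  by case: (consf e); rewrite // -gh.
by case: (conse f); rewrite // gh.
Qed.

(** At the abscissa of [u], [e] would lie between [u] and [f], hence
    inside the wedge below [f]. *)
Lemma last_inside_not_above e f u : last_inside e u -> last_inside f u ->
  e @@ px u < f @@ px u -> False.
Proof.
move=> [g [[_ eG _ _ _] [_ leu ure] _ ue _]] [h [hf [lhu lfu urf] hu uf emp]] ef.
by apply: (wedge_trap hf emp eG); rewrite ?ltW// (lt_trans hu).
Qed.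

Lemma last_inside_inj e f u : e \in G -> f \in G ->
  last_inside e u -> last_inside f u -> e = f.
Proof.
move=> eG fG eu fu.
have [ef|fe|ef] := ltgtP (e @@ px u) (f @@ px u).
- by case: (last_inside_not_above eu fu).
- by case: (last_inside_not_above fu eu).
case: eu fu => [g [_ [_ leu ure] _ _ _]] [h [_ [_ lfu urf] _ _ _]].
by apply: (G_nc eG fG _ _ ef); rewrite ?leu ?lfu.
Qed.

Lemma wedge_below e : e \in G -> ~ lowest e (rgt e) -> exists g, wedge g e.
Proof.
move=> eG nlow.
pose A := [set g in G | (rgt g == rgt e) && (key g < key e)].
have [A0|[g0 g0A]] := set_0Vmem A.
  exfalso; apply: nlow; split=> // g gG ge kge.
  by suff : g \in A; [rewrite A0 inE|rewrite inE gG ge eqxx].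
have [g + gmax] := finset_max_witness key g0A.
rewrite inE => /andP[gG /andP[/eqP ge kge]].
exists g; split=> // h hG he kgh khe.
have := gmax h; rewrite inE hG he eqxx khe => /(_ isT).
by rewrite leNgt kgh.
Qed.

(** Having the kind of the charge as a number in ['I_4] makes the charges a
    product set, whence the factor 4. *)
Definition charge e (t : 'I_4 * V) : Prop :=
  match val t.1 with
  | 0%N => lowest e t.2
  | 1%N => starts_last e t.2
  | 2%N => lower_starts_last e t.2
  | _ => last_inside e t.2
  end.

Lemma charge_exists e : e \in G ->
  exists2 t, t \in finset.setX [set: 'I_4] S & charge e t.
Proof.
move=> eG; have [[leS reS] _ _ lre _] := G_edgeP eG.
have [low|nlow] := pselect (lowest e (rgt e)).
  by exists (inord 0, rgt e);
    [rewrite finset.in_setX finset.in_setT|rewrite /charge /= inordK].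
have [g ge] := wedge_below eG nlow.
have [gG _ rge kge _] := ge; have [[lgS rgS] _ _ lrg _] := G_edgeP gG.
pose A := [set w in S | [&& lx g < px w, lx e < px w, px w < rx e,
  g @@ px w < py w & py w < e @@ px w]].
have [A0|[w0 w0A]] := set_0Vmem A; last first.
  have [u + umax] := finset_max_witness (fun w => px w) w0A.
  rewrite inE => /andP[uS /and5P[gu eu ue gub ube]].
  exists (inord 3, u);
    [by rewrite finset.in_setX finset.in_setT|rewrite /charge /= inordK//].
  exists g; split=> // w wS uw we gw we'.
  have := umax w; rewrite inE wS (lt_trans gu uw) (lt_trans eu uw) we gw we' => /(_ isT).
  by rewrite leNgt uw.
have empty x0 : lx g <= x0 -> lx e <= x0 -> empty_beyond g e x0.
  move=> gx ex w wS xw we gw we'.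
  have : w \in A by rewrite inE wS (le_lt_trans gx xw) (le_lt_trans ex xw) we gw.
  by rewrite A0 inE.
have [lge|leg] := leP (lx g) (lx e).
  exists (inord 1, lft e);
    [by rewrite finset.in_setX finset.in_setT|rewrite /charge /= inordK//].
  by exists g; split=> //; exact: empty.
exists (inord 2, lft g);
    [by rewrite finset.in_setX finset.in_setT|rewrite /charge /= inordK//].
by exists g; split=> //; [exact: ltW|apply: empty => //; exact: ltW].
Qed.

Lemma charge_inj e f t : e \in G -> f \in G -> charge e t -> charge f t -> e = f.
Proof.
move=> eG fG; rewrite /charge; case: (val t.1) => [|[|[|_]]].
- exact: lowest_inj.
- exact: starts_last_inj.
- exact: lower_starts_last_inj.
- exact: last_inside_inj.
Qed.

Lemma card_noncrossing : (#|G| <= 4 * #|S|)%N.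
Proof.
rewrite -{1}[4%N]card_ord -cardsT -finset.cardsX.
exact: card_le_rel charge_exists charge_inj.
Qed.

End Charging.

(** * The crossing inequality *)

(** Edges of [edges P] on a common curve join consecutive vertices, so distinct
    ones have disjoint interiors. *)
Lemma edges_overlap P e f x : e \in edges P -> f \in edges P -> line e = line f ->
  lx e < x < rx e -> lx f < x < rx f -> e = f.
Proof.
move=> /edgesP[[leP reP] ole ore _ ine] /edgesP[[lfP rfP] olf orf _ inf] lef.
move=> /andP[le re] /andP[lf rf].
have lE : lft e = lft f.
  have [ef|fe|ef] := ltgtP (lx e) (lx f); last first.
  - by apply: vertex_eq; rewrite // ole olf lef ef.
  - by case: (inf _ leP); rewrite // ?ole -?lef ?(lt_trans le).
  - by case: (ine _ lfP); rewrite // ?olf ?lef ?(lt_trans lf).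
have rE : rgt e = rgt f.
  have [ef|fe|ef] := ltgtP (rx e) (rx f); last first.
  - by apply: vertex_eq; rewrite // ore orf lef ef.
  - by case: (ine _ rfP); rewrite // ?orf ?lef ?(lt_trans le).
  - by case: (inf _ reP); rewrite // ?ore -?lef ?(lt_trans lf).
clear -lef lE rE; move: lef lE rE; case: e f => [[i u] v] [[j w] z].
by rewrite /line /lft /rgt /= => -> -> ->.
Qed.

Definition crosses e f : Prop := line e != line f /\
  exists x, [/\ lx e < x < rx e, lx f < x < rx f & e @@ x = f @@ x].

Definition crossings P : {set edge * edge} :=
  [set p | [&& p.1 \in edges P, p.2 \in edges P & `[< crosses p.1 p.2 >]]].

Lemma crossingsP P p : reflect [/\ p.1 \in edges P, p.2 \in edges P & crosses p.1 p.2]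
  (p \in crossings P).
Proof. by rewrite [p \in _]finset.in_set; apply: (iffP and3P) => -[? ? /asboolP ?]. Qed.

(** The curves of a crossing pair determine the crossing point, and this point
    determines the edge on each curve. *)
Lemma card_crossings P : (#|crossings P| <= n ^ 2)%N.
Proof.
have -> : (n ^ 2 = #|{: 'I_n * 'I_n}|)%N by rewrite card_prod card_ord mulnn.
rewrite -(@card_in_imset _ _ (fun p : edge * edge => (line p.1, line p.2))).
  exact: max_card.
move=> [e f] [e' f'] /crossingsP/= [eP fP [nef [x [ex fx efx]]]].
move=> /crossingsP/= [e'P f'P [_ [y [ey fy efy]]]] [ee ff].
have xy : x = y by apply: L_once nef efx _; rewrite ee ff.
rewrite -xy in ey fy.
by rewrite (edges_overlap eP e'P ee ex ey) (edges_overlap fP f'P ff fx fy).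
Qed.

Definition ends e : {set V} := [set lft e; rgt e].

Lemma card_ends P e : e \in edges P -> #|ends e| = 2%N.
Proof.
move=> /edgesP[_ _ _ lre _]; rewrite cards2.
by case: eqVneq lre => [->|//]; rewrite ltxx.
Qed.

Lemma edges_end P e v : e \in edges P -> v \in ends e -> py v = e @@ px v.
Proof. by move=> /edgesP[_ ol or_ _ _]; rewrite !inE => /orP[] /eqP ->. Qed.

(** A common end of two crossing edges would be a second common point of their
    curves.  That all four ends are distinct is what makes a crossing survive
    sampling only with probability 1 / q ^ 4. *)
Lemma card_crossing_ends P p : p \in crossings P -> #|ends p.1 :|: ends p.2| = 4%N.
Proof.
move=> /crossingsP[eP fP [nef [x [ex fx efx]]]].
rewrite finset.cardsU (card_ends eP) (card_ends fP).
suff -> : ends p.1 :&: ends p.2 = finset.set0 by rewrite cards0.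
apply/finset.setP => v; rewrite [RHS]inE; apply/negP; rewrite finset.inE => /andP[ve vf].
have vx : px v = x.
  by apply: L_once nef _ efx; rewrite -(edges_end eP ve) (edges_end fP vf).
move: ve ex; rewrite !inE => /orP[] /eqP E; rewrite -vx E ltxx ?andbF //.
Qed.

(** Removing every edge that takes part in a crossing costs at most one edge for
    each ordered crossing pair and leaves a non-crossing graph.  The edges keep
    joining neighbours with respect to [P], which are also neighbours with
    respect to the smaller set [S]. *)
Lemma edge_bound_subset P S : S \subset P ->
  (#|[set e in edges P | ends e \subset S]| <=
   4 * #|S| + #|[set p in crossings P | ends p.1 :|: ends p.2 \subset S]|)%N.
Proof.
move=> SP; set E := [set e in _ | _]; set X := [set p in _ | _].
pose G := E :\: [set p.1 | p in X].
have GS : G \subset edges S.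
  apply/fintype.subsetP => e; rewrite finset.in_setD [e \in E]finset.in_set.
  move=> /andP[_ /andP[eP eS]].
  move/fintype.subsetP: eS => eS.
  have [_ ol or_ lr H] := edgesP P e eP.
  apply/edgesP; split=> //; first by split; apply: eS; rewrite !inE eqxx ?orbT.
  by move=> w wS; apply: H; exact: (fintype.subsetP SP).
have Gnc : noncrossing G.
  move=> e f x; rewrite !finset.in_setD [e \in E]finset.in_set.
  rewrite [f \in E]finset.in_set => /andP[neX /andP[eP eS]] /andP[_ /andP[fP fS]].
  move=> ex fx efx; have [lef|nef] := eqVneq (line e) (line f).
    exact: (edges_overlap eP fP lef ex fx).
  case/negP: neX; apply/imsetP; exists (e, f) => //.
  rewrite [_ \in X]finset.in_set /= finset.subUset eS fS !andbT.
  by apply/crossingsP; split=> //; split=> //; exists x.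
rewrite -(finset.cardsID [set p.1 | p in X] E) addnC; apply: leq_add.
  exact: card_noncrossing GS Gnc.
apply: leq_trans (leq_imset_card (fun p : edge * edge => p.1) X).
by apply/subset_leq_card/finset.subsetIr.
Qed.

(** Random sampling with probability 1 / q, by counting: the sample attached to
    F : V -> 'I_q is the zero set of F, and sums over all F replace
    expectations.  With Q written as a successor, ord0 exists. *)
Section Sampling.
Variable q : nat.
Notation Q := q.+1.

Definition zeros (F : {ffun V -> 'I_Q}) : {set V} := [set v | F v == ord0].

Lemma card_zeros_on (A : {set V}) :
  (#|[set F | A \subset zeros F]| * Q ^ #|A| = Q ^ #|V|)%N.
Proof.
have -> : #|[set F | A \subset zeros F]| =
  #|family (fun v => if v \in A then pred1 (ord0 : 'I_Q) else predT)|.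
  apply: eq_card => F; rewrite finset.inE; apply/fintype.subsetP/familyP => H v.
    by case: ifP => // /H; rewrite inE.
  by move=> vA; move: (H v); rewrite vA !inE.
rewrite card_family foldrE big_map big_enum /=.
rewrite (bigID (mem A)) /= big1 => [|v ->]; last by rewrite card1.
rewrite mul1n (eq_bigr (fun _ => Q)) => [|v /negbTE ->]; last exact: card_ord.
rewrite prod_nat_const -expnD; congr (_ ^ _)%N.
by rewrite addnC -[RHS](cardC (mem A)); congr (_ + _)%N.
Qed.

Lemma sum_sample (T : finType) (B : {set T}) (D : T -> {set V}) d :
  (forall t, t \in B -> #|D t| = d) ->
  ((\sum_F #|[set t in B | D t \subset zeros F]|) * Q ^ d = #|B| * Q ^ #|V|)%N.
Proof.
move=> Dd.
under eq_bigr do rewrite -sum1dep_card big_mkcondr.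
rewrite exchange_big /= big_distrl /= -sum_nat_const; apply: eq_bigr => t tB.
rewrite -(card_zeros_on (D t)) (Dd t tB); congr (_ * _)%N.
by rewrite -sum1dep_card [RHS]big_mkcond.
Qed.

End Sampling.

(** The sampled form of [edge_bound_subset]: vertices, edges and crossings
    survive with probabilities 1 / q, 1 / q ^ 2 and 1 / q ^ 4. *)
Lemma edge_bound P q : (0 < q)%N -> (q ^ 2 * #|edges P| <= 4 * q ^ 3 * #|P| + n ^ 2)%N.
Proof.
case: q => // q _; set Q := q.+1.
have sE := sum_sample q (@card_ends P).
have sX := sum_sample q (@card_crossing_ends P).
have sP := @sum_sample q _ P (fun v => [set v]) 1%N (fun v _ => cards1 v).
have le : (\sum_F #|[set e in edges P | ends e \subset zeros (q := q) F]| <=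
  4 * (\sum_F #|[set v in P | [set v] \subset zeros (q := q) F]|) +
  \sum_F #|[set p in crossings P | ends p.1 :|: ends p.2 \subset zeros (q := q) F]|)%N.
  rewrite big_distrr /= -big_split /=; apply: leq_sum => F _.
  set S := [set v in P | _].
  have SP : S \subset P by apply/fintype.subsetP => v; rewrite inE => /andP[].
  have inS e : e \in edges P -> (ends e \subset zeros F) = (ends e \subset S).
    move=> /edgesP[[lP rP] _ _ _ _]; apply/idP/idP => /fintype.subsetP H;
      apply/fintype.subsetP => v /[dup] ve /H.
      rewrite !finset.inE finset.sub1set inE => ->; rewrite andbT.
      by move: ve; rewrite !inE => /orP[] /eqP ->.
    by rewrite !finset.inE finset.sub1set inE => /andP[].
  have -> : [set e in edges P | ends e \subset zeros F] =
            [set e in edges P | ends e \subset S].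
    apply/finset.setP => e; rewrite [LHS]finset.in_set [RHS]finset.in_set.
    by case: (boolP (e \in edges P)) => //= /inS.
  have -> : [set p in crossings P | ends p.1 :|: ends p.2 \subset zeros F] =
            [set p in crossings P | ends p.1 :|: ends p.2 \subset S].
    apply/finset.setP => p; rewrite [LHS]finset.in_set [RHS]finset.in_set.
    case: (boolP (p \in crossings P)) => //= /crossingsP[eP fP _].
    by rewrite !(finset.subUset _ (ends p.1) (ends p.2)) !inS.
  exact: edge_bound_subset.
have W : (0 < Q ^ #|V|)%N by rewrite expn_gt0.
rewrite -(leq_pmul2r W).
apply: (@leq_trans (4 * Q ^ 3 * #|P| * Q ^ #|V| + #|crossings P| * Q ^ #|V|)).
  rewrite -!mulnA -sE -sX -sP -/Q.
  by move: le; rewrite -(@leq_pmul2r (Q ^ 4)) ?expn_gt0//; congr (_ <= _)%N; ring.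
by rewrite mulnDl leq_add2l leq_mul2r card_crossings orbT.
Qed.

(** * Vertices of high multiplicity *)

Definition mult v : nat := #|[set i | on i v]|.

(** Each vertex of [P] on the curve, except for the leftmost one, is the right
    end of the edge that comes from its left neighbour. *)
Lemma card_on_line P i :
  (#|[set v in P | on i v]| <= #|[set e in edges P | line e == i]|.+1)%N.
Proof.
set B := [set v in P | _]; set E := [set e in _ | _].
have [->|[w0 w0B]] := set_0Vmem B; first by rewrite cards0.
have [v0 v0B v0min] := finset_max_witness (fun v => - px v) w0B.
have Bx u v : u \in B -> v \in B -> px u = px v -> u = v.
  rewrite !inE => /andP[_ /eqP ou] /andP[_ /eqP ov] uv.
  by apply: vertex_eq; rewrite // ou ov uv.
rewrite (cardsD1 v0) v0B add1n ltnS.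
apply: leq_trans (leq_imset_card rgt E).
apply/subset_leq_card/fintype.subsetP => v; rewrite in_setD1 => /andP[vv0 vB].
have v0v : px v0 < px v.
  rewrite lt_neqAle -lerN2 v0min// andbT.
  by apply: contraNneq vv0 => /(Bx _ _ v0B vB) ->.
have [|u] := @finset_max_witness _ _ [set w in B | px w < px v] (fun w => px w) v0.
  by rewrite inE v0B v0v.
rewrite inE => /andP[uB uv] umax.
apply/imsetP; exists (i, u, v) => //; rewrite [_ \in E]finset.in_set eqxx andbT.
have inB w : w \in B -> w \in P /\ py w = L i (px w).
  by rewrite [w \in B]finset.in_set => /andP[wP /eqP].
have [[uP ou] [vP ov]] := (inB _ uB, inB _ vB).
apply/edgesP; split=> // w wP ow uw wv.
have := umax w; rewrite !inE wP /on ow eqxx wv => /(_ isT).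
by rewrite leNgt uw.
Qed.

Lemma incidences_le P : (\sum_(v in P) mult v <= #|edges P| + n)%N.
Proof.
under eq_bigr do rewrite /mult -sum1dep_card big_mkcond.
rewrite exchange_big /=.
apply: (@leq_trans (\sum_(i < n) #|[set e in edges P | line e == i]|.+1)).
  apply: leq_sum => i _; apply: leq_trans (card_on_line P i).
  by rewrite -sum1dep_card big_mkcondr.
under eq_bigr do rewrite -addn1.
rewrite big_split /= sum1_card card_ord leq_add2r.
rewrite -[X in (_ <= X)%N]sum1_card (partition_big line predT) //=.
by apply: leq_sum => i _; rewrite sum1dep_card.
Qed.

(** The crossing inequality for the vertices of multiplicity more than 4 q: just
    these have a positive contribution, and the 4 q ^ 3 |P| of the inequality is
    exactly q ^ 2 times what the excess subtracts. *)
Lemma rich_excess q : (0 < q)%N ->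
  (q ^ 2 * (\sum_v (mult v - 4 * q)) <= q ^ 2 * n + n ^ 2)%N.
Proof.
move=> q0; pose P := [set v | (4 * q < mult v)%N].
have -> : (\sum_v (mult v - 4 * q) = \sum_(v in P) mult v - 4 * q * #|P|)%N.
  rewrite (bigID (mem P)) /= [X in (_ + X)%N]big1 => [|v].
    rewrite addn0 [(4 * q * _)%N]mulnC -sum_nat_const sumnB// => v.
    by rewrite inE => /ltnW.
  by rewrite inE -leqNgt => ?; apply/eqP; rewrite subn_eq0.
have := edge_bound P q0; have := incidences_le P.
rewrite -(@leq_pmul2l (q ^ 2)) ?expn_gt0 ?q0//.
set A := \sum_(v in P) _; set E := #|edges P|; set p := #|P|.
rewrite mulnBr mulnDr.
have -> : (q ^ 2 * (4 * q * p) = 4 * q ^ 3 * p)%N by ring.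
lia.
Qed.

(** * A curve with many vertices *)

Section RichLine.
Hypothesis n_gt1 : (1 < n)%N.
Hypothesis pairs_meet : forall i j, i != j -> exists v, on i v && on j v.
Hypothesis no_center : forall v, exists j, ~~ on j v.

Definition num_on i : nat := #|[set v | on i v]|.

Lemma line_has_vertex i : exists v, on i v.
Proof.
have [j ij] : exists j : 'I_n, i != j.
  pose j0 : 'I_n := Ordinal (ltnW n_gt1); pose j1 : 'I_n := Ordinal n_gt1.
  by have [->|] := eqVneq i j0; [exists j1|exists j0].
by have [v /andP[iv _]] := pairs_meet ij; exists v.
Qed.

(** Every ordered pair of curves, equal or not, has a common vertex. *)
Lemma square_le_sum_mult : (n ^ 2 <= \sum_v mult v ^ 2)%N.
Proof.
have -> : (n ^ 2 = \sum_(i < n) \sum_(j < n) 1)%N.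
  by rewrite !sum1_card card_ord sum_nat_const card_ord mulnn.
have E v : (mult v ^ 2 = \sum_(i < n) \sum_(j < n) (on i v * on j v))%N.
  rewrite -mulnn /mult -sum1dep_card big_mkcond /= big_distrl /=.
  apply: eq_bigr => i _; rewrite big_distrr /=; apply: eq_bigr => j _.
  by case: (on i v); case: (on j v).
rewrite (eq_bigr _ (fun v _ => E v)) [leqRHS]exchange_big /=; apply: leq_sum => i _.
rewrite [leqRHS]exchange_big /=; apply: leq_sum => j _.
have [v /andP[iv jv]] : exists v, on i v && on j v.
  have [->|/pairs_meet//] := eqVneq i j.
  by have [v jv] := line_has_vertex j; exists v; rewrite jv.
by rewrite (bigD1 v) //= iv jv.
Qed.

Lemma sum_mult_num_on : (\sum_v mult v = \sum_i num_on i)%N.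
Proof.
rewrite /mult /num_on.
under eq_bigr do rewrite -sum1dep_card big_mkcond.
rewrite exchange_big /=; apply: eq_bigr => i _.
by rewrite -sum1dep_card [RHS]big_mkcond.
Qed.

(** The curves through [v] meet [j] in distinct vertices, since any two of them
    already meet in [v]. *)
Lemma mult_le_num_on v j : ~~ on j v -> (mult v <= num_on j)%N.
Proof.
move=> jv; apply: (@card_le_rel _ _ _ _ (fun i w => on i w && on j w)).
  move=> i; rewrite inE => iv.
  have [|w ijw] := @pairs_meet i j; first by apply: contraNneq jv => <-.
  by exists w; rewrite // inE; case/andP: ijw.
move=> i k w; rewrite !inE => /eqP iv /eqP kv /andP[/eqP iw jw] /andP[/eqP kw _].
have [//|nik] := eqVneq i k; case/negP: jv.
have wv : px w = px v by apply: (L_once nik); rewrite -?iw -?iv.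
suff <- : w = v by []; by apply: vertex_eq; rewrite // iw iv wv.
Qed.

Lemma rich_line_exists : exists i, (n <= 845 * num_on i)%N.
Proof.
have [i smax] : {i | (\max_j num_on j = num_on i)%N}.
  by apply: bigop.eq_bigmax; rewrite card_ord ltnW.
exists i; apply: (@counting_bound V mult).
- exact: square_le_sum_mult.
- rewrite sum_mult_num_on -[n in (n * _)%N]card_ord -sum_nat_const.
  by apply: leq_sum => j _; rewrite -smax bigop.leq_bigmax.
- move=> v; have [j jv] := no_center v.
  by apply: leq_trans (mult_le_num_on jv) _; rewrite -smax bigop.leq_bigmax.
- exact: rich_excess.
Qed.

End RichLine.
End PlaneGraph.

(** * Pseudoline arrangements *)

Lemma exists_rich_pseudoline (R : realType) (n : nat) (L : 'I_n -> R -> R) :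
  pseudoline_arrangement L -> nontrivial L ->
  exists i, (n <= 845 * num_incident_crossing_points L i)%N.
Proof.
move=> arrL ntL; have [Lc Lm] := arrL.
(* Zero curves and a single curve have a common point, so they are trivial. *)
have n_gt1 : (1 < n)%N.
  rewrite ltnNge; apply/negP => n1; apply: ntL.
  case: n L n1 {arrL Lc Lm} => [|[|//]] L _; first by exists (0, 0) => -[].
  by exists (0, L ord0 0) => i; rewrite (ord1 i).
have fin : finite_set (crossing_point L).
  apply: (@sub_finite_set _ _
      (\bigcup_(i in [set: 'I_n]) incident_crossing_points L i)%classic).
    by move=> p [i [j [ij [ip jp]]]]; exists i => //; split=> //; exists i, j.
  apply: bigcup_finite; first exact: finite_finset.
  by move=> i _; exact: finite_incident_crossing_points.
pose C := fset_set (crossing_point L); pose pt : C -> R * R := val.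
have L_once i j x y : i != j -> L i x = L j x -> L i y = L j y -> x = y.
  move=> ij ijx ijy; have [p [ijp _]] := Lm i j ij.
  have inp z : L i z = L j z -> z = p.1.
    move=> ijz; have : (curve (L i) `&` curve (L j))%classic (z, L i z) by split.
    by rewrite ijp => <-.
  by rewrite (inp x ijx) (inp y ijy).
have meet i j : i != j -> exists v, on L pt i v && on L pt j v.
  move=> ij; have [p [ijp _]] := Lm i j ij.
  have [ip jp] : (curve (L i) `&` curve (L j))%classic p by rewrite ijp.
  have pC : p \in C by rewrite in_fset_set// inE; exists i, j.
  by exists [` pC]%fset; apply/andP; split; apply/eqP.
have nocenter v : exists j, ~~ on L pt j v.
  apply: contrapT => no; apply: ntL; exists (pt v) => i; apply/eqP.
  by apply: contrapT => /negP iv; apply: no; exists i.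
have [i iP] := rich_line_exists Lc L_once val_inj n_gt1 meet nocenter.
exists i; apply: leq_trans iP _; rewrite leq_mul2l /=.
rewrite /num_on cardE -(size_map val); apply: uniq_leq_size.
  by rewrite map_inj_uniq ?enum_uniq//; exact: val_inj.
move=> p /mapP[v]; rewrite mem_enum inE => /eqP iv ->.
rewrite in_fset_set; last exact: finite_incident_crossing_points.
rewrite inE; split=> //.
by have := fsvalP v; rewrite in_fset_set// inE.
Qed.

Theorem theorem8 (R : realType) :
  (exists c : R, 0 < c /\
     forall (n : nat) (L : 'I_n -> R -> R),
       pseudoline_arrangement L -> nontrivial L ->
       exists i : 'I_n, c * n%:R <= (num_incident_crossing_points L i)%:R)
  /\
  (exists n0 : nat,
     forall (n : nat) (L : 'I_n -> R -> R),
       (n0 <= n)%N -> pseudoline_arrangement L -> nontrivial L ->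
       exists i : 'I_n, n%:R / 845%:R <= (num_incident_crossing_points L i)%:R :> R).
Proof.
suff main (n : nat) (L : 'I_n -> R -> R) : pseudoline_arrangement L -> nontrivial L ->
    exists i : 'I_n, n%:R / 845%:R <= (num_incident_crossing_points L i)%:R :> R.
  split; last by exists 0%N => n L _; exact: main.
  exists (845%:R^-1); split; first by rewrite invr_gt0 ltr0n.
  by move=> n L arrL ntL; have [i iP] := main n L arrL ntL; exists i; rewrite mulrC.
move=> arrL ntL; have [i iP] := exists_rich_pseudoline arrL ntL.
by exists i; rewrite ler_pdivrMr ?ltr0n// -natrM ler_nat mulnC.
Qed.
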